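(* For every strike $K\geq 0$, $$V_{f_{LB}}(K)=-\int_K^\infty\Big(\frac{\partial}{\partial k}V_{f_B}(H,k)\Big|_{k=0^+}\Big)\,dH,$$ where the derivative $\frac{\partial}{\partial k}V_{f_B}(H,k)$ exists for all $H$ and $k$ (with $k>0$), and the limit $\big|_{k=0^+}$ exists for all $H$.
   Context: $\mathbb{Q}$ is a probability (pricing) measure, the interest rate is $0$, and $V_f=\mathbb{E}_{\mathbb{Q}}f$ denotes the price of a payoff $f$. $(S_t)_{0\le t\le T}$ is a stock price process with values in $(0,\infty)$, such that $\max_{0\le t\le T}S_t$ exists a.s. and has finite $\mathbb{Q}$-expectation, and the law of $S_T$ under $\mathbb{Q}$ is absolutely continuous with respect to Lebesgue measure on $(0,\infty)$; in particular $\mathbb{Q}(S_T=0)=0$. The maturity $T$ is fixed. The barrier call and look-back call payoffs are $$f_B(H,K)=\mathbf{1}_{\max_{0\le t\le T}S_t\ge H}\,(S_T-K)^+,\qquad f_{LB}(K)=\Big(\max_{0\le t\le T}S_t-K\Big)^+ .$$ The notation $\frac{\partial}{\partial k}V(H,k)|_{k=0^+}$ means the limit as $k\to0^+$ of the derivative in $k$. *)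

(* Defs.v *)
From HB Require Import structures.
From mathcomp Require Export all_boot all_order all_algebra.
From mathcomp Require Export all_classical all_reals all_analysis.
Export Order.TTheory GRing.Theory Num.Theory numFieldNormedType.Exports.

Set Implicit Arguments.
Unset Strict Implicit.
Unset Printing Implicit Defensive.

Local Open Scope classical_set_scope.
Local Open Scope ring_scope.

Section BarrierLookback.
Context {d : measure_display} {Omega : measurableType d} {R : realType}.
Context (Q : probability Omega R).

(* [M] is a version of the maximum of [S] over [0, T]: almost surely the path
   attains a maximum on [0, T], and its value there is [M].  A version is used
   because the pathwise supremum of an uncountable family of random variables
   need not be measurable; the payoffs below depend on the path only through
   [M] and the terminal value [S T]. *)
Definition running_max (S : R -> {RV Q >-> R}) (T : R) (M : {RV Q >-> R}) :=
  {ae Q, forall w, let path := [set S t w | t in `[0, T]] in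
                   path (M w) /\ ubound path (M w)}.

Definition barrier_call (M ST : Omega -> R) (H K : R) (w : Omega) : R :=
  \1_[set w | H <= M w] w * Num.max (ST w - K) 0.

Definition lookback_call (M : Omega -> R) (K : R) (w : Omega) : R :=
  Num.max (M w - K) 0.

Definition price (f : Omega -> R) : \bar R := ('E_Q[f])%E.

(* The derivative is taken of the real number [fine (price _)]; it is
   meaningful where the price is finite. *)
Definition barrier_value (M ST : Omega -> R) (H k : R) : R :=
  fine (price (barrier_call M ST H k)).

Definition barrier_slope (M ST : Omega -> R) (H k : R) : R :=
  derive1 (barrier_value M ST H) k.

End BarrierLookback.

(* Main.v *)
Require Import Defs.
From mathcomp Require Import measurable_realfun lra.

(* With X_H = 1_{M >= H} S_T, the barrier call is the vanilla call (X_H - k)^+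
   for k >= 0.  Its price is convex in k, with difference quotients trapped
   between values of - Q(X_H > .), so its slope is - Q(X_H > k) as soon as X_H
   has no atom at k; this tends to - Q(M >= H) as k -> 0^+ because S_T > 0.
   Integrating Q(M >= H) over H >= K gives E(M - K)^+ by Tonelli. *)

Local Open Scope classical_set_scope.
Local Open Scope ring_scope.

(** Dividing by [b - a] traps the difference quotient between [- g a] and [- g b], and continuity of
    [g] at [k] closes the gap. *)
Lemma is_derive_sandwich (R : realType) (f g : R -> R) (k : R) :
  {for k, continuous g} ->
  (forall a b, a <= b -> (b - a) * g b <= f a - f b <= (b - a) * g a) ->
  is_derive k 1 f (- g k).
Proof.
move=> gk fg.
have key : h^-1 *: ((f \o shift k) (h *: 1) - f k) @[h --> 0^'] --> - g k.
  have gh : g (h + k) @[h --> 0^'] --> g k.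
    have gk0 : g (h + k) @[h --> (0 : R)] --> g k.
      apply: continuous_cvg; first exact: gk.
      rewrite -[X in _ --> X]add0r.
      by apply: cvgD; [exact: cvg_id | exact: cvg_cst].
    by apply: cvg_trans gk0; apply: cvg_app; exact: nbhs_dnbhs.
  have gn : `|g (h + k) - g k| @[h --> 0^'] --> 0.
    rewrite [X in _ --> X](_ : _ = `|g k - g k|); last by rewrite subrr normr0.
    by apply: cvg_norm; apply: cvgB; [exact: gh | exact: cvg_cst].
  have lo : - g k - `|g (h + k) - g k| @[h --> 0^'] --> - g k.
    by rewrite -[X in _ --> X]subr0; apply: cvgB; [exact: cvg_cst | exact: gn].
  have hi : - g k + `|g (h + k) - g k| @[h --> 0^'] --> - g k.
    by rewrite -[X in _ --> X]addr0; apply: cvgD; [exact: cvg_cst | exact: gn].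
  apply: (squeeze_cvgr _ lo hi); near=> h => /=.
  have h0 : h != 0 by near: h; exact: nbhs_dnbhs_neq.
  (* Both bounds merge into one estimate of the distance to [- g k]. Multiplied by [|h|], it follows
     from [fg] at the endpoints [k] and [h + k], ordered by the sign of [h]. *)
  rewrite /shift /= [h%:A]mulr1 -ler_distl opprK.
  rewrite -[_ *: _]/(_ * _) -[X in `|_ + X|](mulKf h0) -mulrDr normrM.
  rewrite normrV ?unitfE// ler_pdivrMl ?normr_gt0//.
  have [hneg|hpos|h00] := ltgtP h 0; last by rewrite h00 eqxx in h0.
  - have /andP[l u] := fg (h + k) k ltac:(lra).
    rewrite [`|h|]ltr0_norm// ler_norml; apply/andP; split.
      have := ler_norm (g (h + k) - g k); nra.
    have := ler_norm (g (h + k) - g k); nra.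
  - have /andP[l u] := fg k (h + k) ltac:(lra).
    have := ler_norm (g k - g (h + k)); rewrite distrC => gle.
    rewrite [`|h|]gtr0_norm// ler_norml; apply/andP; split; nra.
apply: DeriveDef; first by apply/cvg_ex; exists (- g k).
exact: cvg_lim key.
Unshelve. all: by end_near. Qed.

Section call.
Context {d : measure_display} {T : measurableType d} {R : realType}.
Context {P : probability T R}.

(** A tail function is always right continuous, and its jump from the left at [k] is the mass of the
    atom there. *)
Lemma ccdf_continuous (X : {RV P >-> R}) (k : R) :
  P (X @^-1` [set k]) = 0%E -> {for k, continuous (fine \o ccdf X)}.
Proof.
move=> Xk0.
have fin (Y : {RV P >-> R}) r : ccdf Y r \is a fin_num.
  exact: fin_num_measure.
have right (Y : {RV P >-> R}) r : fine (ccdf Y x) @[x --> r^'+] --> fine (ccdf Y r).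
  by apply: fine_cvg; rewrite fineK//; exact: ccdf_right_continuous.
apply/left_right_continuousP; split; last exact: right.
(* Left continuity is right continuity of the cdf of [- X], since
   [P (X >= r)] and [P (X > r)] agree at [r = k]. *)
apply/cvg_at_leftNP.
pose Y : {RV P >-> R} := (- X)%R.
have finY r : cdf Y r \is a fin_num by exact: fin_num_measure.
have YE r : cdf Y r = P (X @^-1` `[- r, +oo[).
  rewrite /cdf/= /distribution /pushforward; congr (P _).
  by apply/seteqP; split => w /=; rewrite !in_itv/= andbT lerNl.
have Yk : cdf Y (- k) = ccdf X k.
  rewrite YE opprK /ccdf/= /distribution /pushforward.
  rewrite -(@setU1itv _ _ _ _ false)// preimage_setU measureU//.
  - by rewrite [X in (X + _)%E](_ : _ = 0%E) ?add0e.
  - exact: measurable_funPTI.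
  - by apply/seteqP; split => // w /= [->]; rewrite in_itv/= ltxx.
have lim : fine (cdf Y x) @[x --> (- k)^'+] --> fine (ccdf X k).
  by apply: fine_cvg; rewrite fineK// -Yk; exact: cdf_right_continuous.
(* For [x] to the right of [- k], the value [ccdf X (- x)] is at least [ccdf X k] by monotonicity
   and at most [P (X >= - x)], which is [cdf Y x]. *)
apply: (squeeze_cvgr _ (cvg_cst _) lim); near=> x => /=.
have kx : - x < k by rewrite ltrNl; near: x; exact: nbhs_right_gt.
apply/andP; split; rewrite fine_le//.
  by rewrite ccdf_nonincreasing// ltW.
rewrite YE /ccdf /distribution /pushforward.
have mX (i : interval R) : d.-measurable (X @^-1` [set` i]).
  exact: measurable_funPTI.
apply: le_measure; rewrite ?inE//.
by move=> w /=; rewrite !in_itv/= !andbT => /ltW.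
Unshelve. all: by end_near. Qed.

Lemma call_integrable (X : {RV P >-> R}) (k : R) :
  P.-integrable [set: T] (EFin \o X) ->
  P.-integrable [set: T] (EFin \o lookback_call X k).
Proof.
move=> iX.
have ik : P.-integrable [set: T] (EFin \o (fun w => X w - k)).
  apply: (eq_integrable measurableT (fun w => (X w)%:E - k%:E)%E) => //.
  apply: integrableB => //.
  exact: finite_measure_integrable_cst.
apply: le_integrable ik => //.
  apply/measurable_EFinP; apply: measurable_maxr => //.
  exact: measurable_funB.
move=> w _ /=; rewrite lee_fin /lookback_call.
by case: (leP (X w - k) 0) => h; rewrite ?normr0.
Qed.

(** Pointwise, the spread [(X - a)^+ - (X - b)^+] stays in [[0, b - a]], equals [b - a] where
    [X > b] and vanishes where [X <= a]. Taking expectations gives both bounds. *)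
Lemma call_spread (X : {RV P >-> R}) (a b : R) :
  P.-integrable [set: T] (EFin \o X) -> a <= b ->
  (b - a) * fine (ccdf X b) <=
    fine 'E_P[lookback_call X a] - fine 'E_P[lookback_call X b] <=
  (b - a) * fine (ccdf X a).
Proof.
move=> iX ab.
pose I r : T -> R := \1_(X @^-1` `]r, +oo[).
have mI r : d.-measurable (X @^-1` `]r, +oo[) by exact: measurable_funPTI.
have iI r : P.-integrable [set: T] (EFin \o I r).
  by apply: integrable_indic.
have IE r : fine (ccdf X r) = \int[P]_x I r x.
  by rewrite /Rintegral /I integral_indic// setIT.
have ibI r : P.-integrable [set: T] (EFin \o (fun w => (b - a) * I r w)).
  apply: (eq_integrable measurableT (fun w => (b - a)%:E * (I r w)%:E)%E) => //.
  exact: (integrableZl measurableT _ (iI r)).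
have iC k : P.-integrable [set: T] (EFin \o lookback_call X k).
  exact: call_integrable.
have CE : fine 'E_P[lookback_call X a] - fine 'E_P[lookback_call X b] =
    \int[P]_x (lookback_call X a x - lookback_call X b x).
  by rewrite RintegralB// unlock.
have iCC : P.-integrable [set: T]
    (EFin \o (fun w => lookback_call X a w - lookback_call X b w)).
  apply: (eq_integrable measurableT
    (fun w => (lookback_call X a w)%:E - (lookback_call X b w)%:E)%E) => //.
  exact: (integrableB measurableT (iC a) (iC b)).
have IX r w : I r w = (r < X w)%R%:R.
  rewrite /I indicE; congr ((nat_of_bool _)%:R).
  by apply/idP/idP; rewrite inE/= in_itv/= andbT.
rewrite CE !IE -!RintegralZl//; apply/andP; split; apply: le_Rintegral => // w _;
  rewrite IX /lookback_call.
  case: (ltP b (X w)) => bX; case: (leP (X w - a) 0) => ?;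
    case: (leP (X w - b) 0) => ?; rewrite ?mulr1 ?mulr0; lra.
case: (ltP a (X w)) => bX; case: (leP (X w - a) 0) => ?;
  case: (leP (X w - b) 0) => ?; rewrite ?mulr1 ?mulr0; lra.
Qed.

(** First-order Breeden-Litzenberger formula: [call_spread] supplies the sandwich, with the tail
    function as [g]. *)
Lemma is_derive_call (X : {RV P >-> R}) (k : R) :
  P.-integrable [set: T] (EFin \o X) -> P (X @^-1` [set k]) = 0%E ->
  is_derive k 1 (fun k => fine 'E_P[lookback_call X k]) (- fine (ccdf X k)).
Proof.
move=> iX Xk0; apply: (@is_derive_sandwich R _ (fine \o ccdf X)).
  exact: ccdf_continuous.
by move=> a b ab; exact: call_spread.
Qed.

(** Layer-cake argument: [(X - K)^+] is the Lebesgue length of [[K, X]], an interval that is empty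
    when [X < K], and Tonelli exchanges this length with the expectation. *)
Lemma expectation_call_tail (X : {RV P >-> R}) (K : R) :
  ('E_P[lookback_call X K] =
   \int[@lebesgue_measure R]_(H in `[K, +oo[) P (X @^-1` `[H, +oo[))%E.
Proof.
pose f (p : T * measurableTypeR R) : \bar R := (\1_`[K, X p.1] p.2)%:E.
transitivity (\int[P]_w \int[@lebesgue_measure R]_H f (w, H))%E.
  rewrite unlock; apply: eq_integral => w _.
  rewrite /f/= integral_indic// setIT/= lebesgue_measure_itv/= lte_fin /lookback_call.
  case: ltP => KX; first by rewrite max_l// subr_ge0 ltW.
  by rewrite max_r// subr_le0.
rewrite fubini_tonelli//=; last 2 first.
- apply/measurable_EFinP/measurable_indic => /=.
  pose fK (p : T * measurableTypeR R) := K <= p.2.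
  pose fX (p : T * measurableTypeR R) := p.2 <= X p.1.
  (* The region [K <= H <= X w] is jointly measurable, being cut out by two comparisons of
     measurable functions. *)
  rewrite [X in measurable X](_ : _ =
      fK @^-1` [set true] `&` fX @^-1` [set true]); last first.
    by apply/seteqP; split => p; rewrite /= in_itv/= => /andP.
  apply: measurableI.
  - have : measurable_fun setT fK by exact: measurable_fun_ler.
    by move=> /(_ measurableT [set true]); rewrite setTI; exact.
  - have : measurable_fun setT fX.
      by apply: measurable_fun_ler => //; exact: measurableT_comp.
    by move=> /(_ measurableT [set true]); rewrite setTI; exact.
- by move=> p; rewrite lee_fin.
(* Slices at [H < K] are empty, so the integral over the whole line reduces to [[K, +oo[]. *)
rewrite [RHS]integral_mkcond; apply: eq_integral => H _.
rewrite patchE; have [KH|HK] := leP K H.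
  rewrite mem_set/= ?in_itv/= ?KH//.
  transitivity (\int[P]_w (\1_(X @^-1` `[H, +oo[) w)%:E)%E.
    apply: eq_integral => w _; rewrite /f/= !indicE; congr ((nat_of_bool _)%:R%:E).
    by apply/idP/idP; rewrite !inE/= !in_itv/= KH/= andbT.
  by rewrite integral_indic ?setIT//; exact: measurable_funPTI.
rewrite memNset/= ?in_itv/= ?leNgt ?HK//.
apply: integral0_eq => w _; rewrite /f indicE memNset//=.
by rewrite in_itv/= leNgt HK.
Qed.

End call.

Theorem theorem2p2 (d : measure_display) (Omega : measurableType d)
    (R : realType) (Q : probability Omega R)
    (T : R) (T_ge0 : 0 <= T)
    (S : R -> {RV Q >-> R})
    (S_gt0 : forall t w, t \in `[0, T] -> 0 < S t w)
    (M : {RV Q >-> R}) (S_max : running_max S T M)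
    (M_int : Q.-integrable [set: Omega] (EFin \o M))
    (ST_ac : distribution Q (S T) `<<
               mrestr (@lebesgue_measure R) (measurable_itv `]0, +oo[)) :
  [/\ forall H k : R, 0 < k ->
        price Q (barrier_call M (S T) H k) \is a fin_num /\
        derivable (barrier_value Q M (S T) H) k 1,
      forall H : R, cvg (barrier_slope Q M (S T) H k @[k --> 0^'+])
    & forall K : R, 0 <= K ->
        price Q (lookback_call M K) =
        (- \int[@lebesgue_measure R]_(H in `[K, +oo[)
             (lim (barrier_slope Q M (S T) H k @[k --> 0^'+]))%:E)%E].
Proof.
have T_in : T \in `[0, T] by rewrite in_itv/= T_ge0 lexx.
have ST0 w : 0 < S T w by exact: S_gt0.
have ST_M : {ae Q, forall w, S T w <= M w}.
  apply: filterS S_max => w /= [_]; apply.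
  by exists T => //=.
pose A H := M @^-1` `[H, +oo[.
have mA H : d.-measurable (A H) by exact: measurable_funPTI.
(* The payoff [1_{M >= H} S_T] is packed as a random variable so that the lemmas on calls apply with
   it as underlying; only the formula [XE] is kept. *)
have [X XE] : exists X : R -> {RV Q >-> R},
    forall H w, X H w = (H <= M w)%R%:R * S T w.
  have mX H : measurable_fun setT (fun w => \1_(A H) w * S T w).
    by apply: measurable_funM => //; exact: measurable_indic.
  exists (fun H => mfun_Sub (mem_set (mX H))) => H w /=.
  rewrite indicE; congr ((nat_of_bool _)%:R * _).
  by apply/idP/idP; rewrite inE /A/= in_itv/= andbT.
(* Domination: [|X H| <= S T <= M] almost surely, and [M] is integrable. *)
have iX H : Q.-integrable [set: Omega] (EFin \o X H).
  have [_ M_fin] := integrableP _ _ _ M_int.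
  apply/integrableP; split; first exact/measurable_EFinP.
  apply: le_lt_trans M_fin; apply: ae_ge0_le_integral => //.
  - by apply: measurableT_comp => //; exact/measurable_EFinP.
  - by apply: measurableT_comp => //; exact/measurable_EFinP.
  apply: filterS ST_M => w STM _; rewrite /= lee_fin XE.
  rewrite (ger0_norm (le_trans (ltW (ST0 w)) STM)) normrM (gtr0_norm (ST0 w)).
  apply: le_trans STM; rewrite normr_nat ler_piMl ?(ltW (ST0 w))//.
  by case: (H <= M w).
(* Where the barrier is not reached, the call on [X H] pays [(- k)^+], which is zero only because
   [k >= 0]. *)
have barrierE (H k : R) : 0 <= k -> barrier_call M (S T) H k = lookback_call (X H) k.
  move=> k0; apply/funext => w; rewrite /barrier_call /lookback_call XE indicE.
  rewrite (_ : (w \in _) = (H <= M w)); last by apply/idP/idP; rewrite inE.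
  by case: (H <= M w); rewrite ?mul1r// !mul0r sub0r max_r// oppr_le0.
(* [X H] may have an atom at 0, from the event [M < H]; for [k > 0], however, [X H = k] forces
   [S T = k], a null event by absolute continuity. *)
have X_atomless (H k : R) : 0 < k -> Q (X H @^-1` [set k]) = 0%E.
  have ST_k : (distribution Q (S T)).-null_set [set k].
    apply: ST_ac => B mB Bk; apply/eqP; rewrite eq_le measure_ge0 andbT.
    rewrite -(@lebesgue_measure_set1 R k); apply: le_measure; rewrite ?inE//.
      exact: measurableI.
    by move=> x [/Bk].
  move=> k0; have {}ST_k : Q (S T @^-1` [set k]) = 0%E.
    exact: (ST_k _ (measurable_set1 k) (@subset_refl _ _)).
  apply/eqP; rewrite eq_le measure_ge0 andbT -ST_k.
  apply: le_measure; rewrite ?inE; [exact: measurable_funPTI..|].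
  move=> w /=; rewrite XE; case: (H <= M w); first by rewrite mul1r.
  by rewrite mul0r => k_eq0; rewrite k_eq0 ltxx in k0.
have slope (H k : R) : 0 < k ->
    is_derive k 1 (barrier_value Q M (S T) H) (- fine (ccdf (X H) k)).
  move=> k0.
  (* The barrier price agrees with the call price only at nonnegative strikes; these form a
     neighbourhood of [k] since [k > 0]. *)
  apply: near_eq_is_derive (is_derive_call _ _ (iX H) (X_atomless H k k0)).
  near=> r; rewrite /barrier_value /price barrierE//.
  by near: r; exact: lt_le_nbhsr.
have lim_slope H : barrier_slope Q M (S T) H k @[k --> 0^'+] -->
    - fine (Q (A H)).
  (* Positivity of [S T] enters here: [X H > 0] exactly when [M >= H]. Right continuity of the tail
     at 0 then gives the limit, whatever mass [X H] has at 0. *)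
  have -> : Q (A H) = ccdf (X H) 0.
    congr (Q _); apply/seteqP; split => w; rewrite /A/= !in_itv/= !andbT XE.
      by move=> ->; rewrite mul1r.
    by case: (H <= M w); rewrite ?mul0r ?ltxx.
  have : - fine (ccdf (X H) k) @[k --> 0^'+] --> - fine (ccdf (X H) 0).
    apply: cvgN; apply: fine_cvg; rewrite fineK ?fin_num_measure//.
    exact: ccdf_right_continuous.
  apply: cvg_trans; apply: near_eq_cvg; near=> k.
  have k0 : 0 < k by near: k; exact: nbhs_right_gt.
  by rewrite /barrier_slope derive1E; have [_ ->] := slope H k k0.
split.
- move=> H k k0; split; last by have [] := slope H k k0.
  rewrite /price barrierE ?ltW// unlock.
  exact: (integrable_fin_num measurableT (call_integrable _ k (iX H))).
- by move=> H; apply/cvg_ex; exists (- fine (Q (A H))); exact: lim_slope.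
- move=> K _; rewrite /price expectation_call_tail.
  (* The two signs cancel because [Q (A H)] is nonnegative; each [- Q (A H)] is then recognised as
     the limit slope. *)
  transitivity (- \int[@lebesgue_measure R]_(H in `[K, +oo[) - Q (A H))%E.
    by rewrite integral_ge0N ?oppeK// => H _; exact: measure_ge0.
  congr (- _)%E; apply: eq_integral => H _.
  by rewrite (cvg_lim _ (lim_slope H))// EFinN fineK// fin_num_measure.
Unshelve. all: by end_near.
Qed.
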